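(* As formal power series in $z$ with coefficients in $\mathbb{Q}(c,q)$, $$\cfrac{1}{1-b_0z-\cfrac{a_1z}{1-b_1z-\cfrac{a_2z}{1-b_2z-\cdots}}}=\cfrac{1}{1-\cfrac{\lambda_1z}{1-\cfrac{\lambda_2z}{1-\cdots}}},$$ where $$a_n=\frac{cq^{2n-1}}{(1-cq^{n-1})(1-cq^n)}\ (n\ge1),\qquad b_n=\frac{q^n}{1-cq^n}\ (n\ge0),$$ $$\lambda_{2n}=\frac{cq^{3n-1}}{(1-cq^{2n-1})(1-cq^{2n})}\ (n\ge1),\qquad \lambda_{2n+1}=\frac{q^n}{(1-cq^{2n})(1-cq^{2n+1})}\ (n\ge0).$$
   Context: $c$ and $q$ are indeterminates. Infinite continued fractions are understood as limits of their finite truncations in the ring of formal power series in $z$. *)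

(* Defs.v *)
From HB Require Import structures.
From mathcomp Require Import all_boot all_order all_algebra.
From mathcomp Require Import boolp.
From mathcomp Require Import mpoly.

Set Implicit Arguments.
Unset Strict Implicit.
Unset Printing Implicit Defensive.

Import GRing.Theory.
Local Open Scope ring_scope.

Record fps (K : Type) := Fps { coefs : nat -> K }.

Lemma fpsP (K : Type) (f g : fps K) : coefs f =1 coefs g -> f = g.
Proof. by case: f g => [f] [g] /= /funext ->. Qed.

HB.instance Definition _ (K : Type) := gen_eqMixin (fps K).
HB.instance Definition _ (K : Type) := gen_choiceMixin (fps K).

Section FpsRing.
Variable K : comNzRingType.
Implicit Types f g h : fps K.

Definition fpsC (a : K) : fps K := Fps (fun n => if n is 0 then a else 0).
Definition fpsX : fps K := Fps (fun n => (n == 1)%:R).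

Definition fps_add f g : fps K := Fps (fun n => coefs f n + coefs g n).
Definition fps_opp f : fps K := Fps (fun n => - coefs f n).
Definition fps_mul f g : fps K :=
  Fps (fun n => \sum_(i < n.+1) coefs f i * coefs g (n - i)).

Lemma coefs_mul f g n :
  coefs (fps_mul f g) n = \sum_(i < n.+1) coefs f i * coefs g (n - i).
Proof. by []. Qed.

Lemma fps_addA : associative fps_add.
Proof. by move=> f g h; apply: fpsP => n /=; rewrite addrA. Qed.
Lemma fps_addC : commutative fps_add.
Proof. by move=> f g; apply: fpsP => n /=; rewrite addrC. Qed.
Lemma fps_add0 : left_id (fpsC 0) fps_add.
Proof. by move=> f; apply: fpsP => -[|n] /=; rewrite add0r. Qed.
Lemma fps_addN : left_inverse (fpsC 0) fps_opp fps_add.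
Proof. by move=> f; apply: fpsP => -[|n] /=; rewrite addNr. Qed.

HB.instance Definition _ := GRing.isZmodule.Build (fps K)
  fps_addA fps_addC fps_add0 fps_addN.

(* The ring axioms are inherited from {poly K}: the coefficients of index < N
   of a product only depend on the truncations at order N. *)
Definition fps_trunc N f : {poly K} := \poly_(i < N) coefs f i.

Lemma fps_mul_poly N f g n : (n < N)%N ->
  coefs (fps_mul f g) n = (fps_trunc N f * fps_trunc N g)`_n.
Proof.
move=> nN; rewrite coefs_mul coefM; apply: eq_bigr => i _; rewrite !coef_poly.
have iN : (i < N)%N by apply: leq_ltn_trans nN; rewrite -ltnS.
by rewrite iN (leq_ltn_trans (leq_subr _ _) nN).
Qed.

Lemma fps_mulC : commutative fps_mul.
Proof.
by move=> f g; apply: fpsP => n; rewrite !(@fps_mul_poly n.+1) // mulrC.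
Qed.

Lemma fps_mulA : associative fps_mul.
Proof.
move=> f g h; apply: fpsP => n; pose N := n.+1.
have -> : coefs (fps_mul f (fps_mul g h)) n =
    (fps_trunc N f * (fps_trunc N g * fps_trunc N h))`_n.
  rewrite coefs_mul coefM; apply: eq_bigr => i _.
  by rewrite coef_poly ltn_ord (@fps_mul_poly N) // ltnS leq_subr.
rewrite mulrA coefM coefs_mul; apply: eq_bigr => i _.
by rewrite (@fps_mul_poly N) // coef_poly ltnS leq_subr.
Qed.

Lemma fps_mul1 : left_id (fpsC 1) fps_mul.
Proof.
move=> f; apply: fpsP => n /=; rewrite big_ord_recl /= mul1r subn0.
by rewrite big1 ?addr0 // => i _; rewrite mul0r.
Qed.

Lemma fps_mulDl : left_distributive fps_mul fps_add.
Proof.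
move=> f g h; apply: fpsP => n /=; rewrite -big_split /=.
by apply: eq_bigr => i _; rewrite mulrDl.
Qed.

Lemma fps_oner_neq0 : fpsC 1 != 0.
Proof.
by apply/eqP => /(congr1 (fun f => coefs f 0)) /eqP; rewrite /= oner_eq0.
Qed.

HB.instance Definition _ := GRing.Zmodule_isComNzRing.Build (fps K)
  fps_mulA fps_mulC fps_mul1 fps_mulDl fps_oner_neq0.

(* Limits in K[[z]] for the z-adic topology: each coefficient is eventually
   constant. *)
Definition fps_cvg (u : nat -> fps K) (f : fps K) : Prop :=
  forall k, exists N, forall n, (N <= n)%N -> coefs (u n) k = coefs f k.

Lemma fps_cvg_unique (u : nat -> fps K) f g :
  fps_cvg u f -> fps_cvg u g -> f = g.
Proof.
move=> uf ug; apply: fpsP => k; have [N Nf] := uf k; have [M Mg] := ug k.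
by rewrite -(Nf (maxn N M)) ?leq_maxl // Mg // leq_maxr.
Qed.

End FpsRing.

Arguments fpsX {K}.

Section FpsUnit.
Variable K : comUnitRingType.
Implicit Types f g : fps K.

(* fps_invs f n lists the coefficients of 1 / f of index n, n - 1, ..., 0. *)
Fixpoint fps_invs f n : seq K :=
  if n is m.+1 then
    let s := fps_invs f m in
    - (coefs f 0)^-1 * (\sum_(i < n) coefs f i.+1 * s`_i) :: s
  else [:: (coefs f 0)^-1].

Definition fps_unit : pred (fps K) := fun f => coefs f 0 \is a GRing.unit.

(* As for the other inverses of the library, non-units are left unchanged. *)
Definition fps_inv f : fps K :=
  if fps_unit f then Fps (fun n => (fps_invs f n)`_0) else f.

Lemma nth_fps_invs f n i : (i <= n)%N ->
  (fps_invs f n)`_i = (fps_invs f (n - i))`_0.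
Proof.
elim: n i => [|n IHn] [|i] //= le_in.
by rewrite IHn // subSS.
Qed.

Lemma fps_mulVf : {in fps_unit, left_inverse 1 fps_inv *%R}.
Proof.
move=> f Uf; have U0 : coefs f 0 \is a GRing.unit := Uf.
rewrite mulrC /fps_inv (_ : fps_unit f = true) //.
apply: fpsP => -[|n]; rewrite /= big_ord_recl /=.
  by rewrite big_ord0 addr0 divrr.
rewrite mulrA mulrN divrr // mulN1r.
apply/eqP; rewrite addrC subr_eq0; apply/eqP; apply: eq_bigr => i _.
by rewrite subSS (@nth_fps_invs f n i) // -ltnS.
Qed.

Lemma fps_unitP f g : g * f = 1 -> fps_unit f.
Proof.
move=> /(congr1 (fun h => coefs h 0)) /=.
rewrite big_ord_recl big_ord0 addr0 /= => fg1.
by apply/unitrP; exists (coefs g 0); split=> //; rewrite mulrC.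
Qed.

Lemma fps_inv_out : {in [predC fps_unit], fps_inv =1 id}.
Proof. by move=> f /negbTE nUf; rewrite /fps_inv (_ : fps_unit f = false). Qed.

HB.instance Definition _ := GRing.ComNzRing_hasMulInverse.Build (fps K)
  fps_mulVf fps_unitP fps_inv_out.

(* The finite truncations
     1 / (1 - b_0 z - a_1 z / (1 - b_1 z - ... - a_n z / (1 - b_n z)))
   and
     1 / (1 - l_1 z / (1 - ... - l_n z / 1));
   a_0 and l_0 are not used. All denominators have constant coefficient 1,
   hence are units. *)
Fixpoint Tfrac (a b : nat -> K) (n : nat) : fps K :=
  if n is m.+1 then
    1 / (1 - fpsC (b 0) * fpsX
           - fpsC (a 1) * fpsX * Tfrac (fun k => a k.+1) (fun k => b k.+1) m)
  else 1 / (1 - fpsC (b 0) * fpsX).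

Fixpoint Sfrac (l : nat -> K) (n : nat) : fps K :=
  if n is m.+1 then
    1 / (1 - fpsC (l 1) * fpsX * Sfrac (fun k => l k.+1) m)
  else 1.

End FpsUnit.

Definition Qcq : fieldType := {fraction {mpoly rat[2]}}.
Definition c : Qcq := tofrac ('X_(inord 0) : {mpoly rat[2]}).
Definition q : Qcq := tofrac ('X_(inord 1) : {mpoly rat[2]}).

(* The truncated exponents 2 * n - 1, n - 1 and 3 * m - 1 are the intended
   ones for n, m >= 1. *)
Definition a_ (n : nat) : Qcq :=
  c * q ^+ (2 * n - 1) / ((1 - c * q ^+ (n - 1)) * (1 - c * q ^+ n)).

Definition b_ (n : nat) : Qcq := q ^+ n / (1 - c * q ^+ n).

Definition lambda_ (n : nat) : Qcq :=
  let m := n./2 in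
  if odd n then q ^+ m / ((1 - c * q ^+ (2 * m)) * (1 - c * q ^+ (2 * m + 1)))
  else c * q ^+ (3 * m - 1)
         / ((1 - c * q ^+ (2 * m - 1)) * (1 - c * q ^+ (2 * m))).

(* Main.v *)
Require Import Defs.
From mathcomp Require Import all_boot all_algebra.
From mathcomp Require Import mpoly ring zify.

(** Both continued fractions are quotients of two confluent basic
hypergeometric series. Put
  phi m k = sum_n (-1)^n q^(n(n-1)/2 + m n) z^n / ((q; q)_n (c q^k; q)_n).
Comparing coefficients gives three contiguous relations ([qhyp_shift_both],
[qhyp_shift_lower], [qhyp_shift_split]) between neighbours of phi m k.
Along the staircase
  G_(2m) = phi m (2m),   G_(2m+1) = phi (m+1) (2m+1)
the first two relations alternate and read
  G_k = G_(k+1) - lambda_(k+1) z G_(k+2),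
and along the diagonal H_k = phi k k the first and the third combine into
  H_k = (1 - b_k z) H_(k+1) - a_(k+1) z H_(k+2).
Dividing by the middle term and iterating unfolds G_1 / G_0 into the
right-hand fraction and H_1 / H_0 into the left-hand one; each further level
pushes the remainder one power of z higher ([Tfrac_remainder]), so the
truncations converge to these quotients. The two sequences start with the same
two series, G_0 = H_0 and G_1 = H_1, hence the two limits coincide.

The series have coefficients in Q(c, q) because 1 - q^(n+1) and 1 - c q^n are
values of polynomials equal to 1 at c = q = 0, hence are nonzero
([q_generic], [cq_generic]). *)

Set Implicit Arguments.
Unset Strict Implicit.
Unset Printing Implicit Defensive.

Import GRing.Theory.
Local Open Scope ring_scope.

Section Coefficients.
Variable K : comNzRingType.
Implicit Types (f g : fps K) (x : K).

Lemma coefsD f g n : coefs (f + g) n = coefs f n + coefs g n.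
Proof. by []. Qed.

Lemma coefsN f n : coefs (- f) n = - coefs f n.
Proof. by []. Qed.

Lemma coefs0M f g : coefs (f * g) 0 = coefs f 0 * coefs g 0.
Proof. by rewrite [LHS]coefs_mul big_ord_recl big_ord0 addr0. Qed.

Lemma coefsCM x f n : coefs (fpsC x * f) n = x * coefs f n.
Proof.
rewrite [LHS]coefs_mul big_ord_recl subn0 big1 ?addr0 // => i _.
by rewrite mul0r.
Qed.

Lemma coefs0XM f : coefs (fpsX * f) 0 = 0.
Proof. by rewrite coefs0M mul0r. Qed.

Lemma coefsXM f n : coefs (fpsX * f) n.+1 = coefs f n.
Proof.
rewrite [LHS]coefs_mul !big_ord_recl big1 ?addr0 /= => [|i _].
  by rewrite mul0r add0r mul1r subSS subn0.
by rewrite mul0r.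
Qed.

Lemma coefsXnM N f n : (n < N)%N -> coefs (fpsX ^+ N * f) n = 0.
Proof.
elim: N n => // N IHN [|n] lt_nN; rewrite exprS -mulrA ?coefs0XM //.
by rewrite coefsXM IHN.
Qed.

Lemma fpsCM x y : fpsC (x * y) = fpsC x * fpsC y.
Proof. by apply: fpsP => -[|n]; rewrite coefsCM //= mulr0. Qed.

Lemma fpsC0 : fpsC 0 = 0 :> fps K.
Proof. by []. Qed.

End Coefficients.

(** * Continued fractions from three-term recurrences *)

Section Recurrences.
Variable K : comUnitRingType.
Implicit Types (H : nat -> fps K) (a b l : nat -> K).

Lemma fps_unit_coefs0 (f : fps K) : coefs f 0 = 1 -> f \is a GRing.unit.
Proof. by move=> f0; rewrite -topredE /= /fps_unit f0 unitr1. Qed.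

Lemma Sfrac_Tfrac l n : Sfrac l n = Tfrac l (fun=> 0) n.
Proof.
elim: n l => [|n IHn] l /=; first by rewrite fpsC0 mul0r subr0 divr1.
by rewrite fpsC0 mul0r subr0 IHn.
Qed.

(** Each level of the fraction multiplies the remainder of the level below it
by [a_1 z] and the inverse of a denominator, which raises its order in [z] by
one. Writing the remainder as [T * H 0 - H 1] rather than [T - H 1 / H 0] keeps
the invertibility of the [H k] out of the induction. *)
Lemma Tfrac_remainder a b H n :
    (forall k, H k = (1 - fpsC (b k) * fpsX) * H k.+1
                     - fpsC (a k.+1) * fpsX * H k.+2) ->
  exists h, Tfrac a b n * H 0 - H 1 = fpsX ^+ n.+1 * h.
Proof.
elim: n a b H => [|n IHn] a b H recH /=.
  set D := 1 - _; have uD : D \is a GRing.unit.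
    by apply: fps_unit_coefs0; rewrite coefsD coefsN coefsCM mulr0 subr0.
  exists (- (D^-1 * fpsC (a 1) * H 2)).
  rewrite {1}(recH 0) -/D mulrBr mul1r mulKr //; ring.
have [k | h Eh] := IHn (a \o succn) (b \o succn) (H \o succn).
  exact: recH.
set T := Tfrac _ _ n in Eh *; set D := 1 - _ - _.
have uD : D \is a GRing.unit.
  apply: fps_unit_coefs0.
  by rewrite !coefsD !coefsN coefsCM -mulrA coefsCM coefs0XM !mulr0 !subr0.
have EH : H 0 = D * H 1 + fpsC (a 1) * fpsX * (T * H 1 - H 2).
  by rewrite {1}(recH 0) /D; ring.
exists (D^-1 * fpsC (a 1) * h).
rewrite EH Eh mulrDr mul1r mulKr // [fpsX ^+ n.+2]exprS; ring.
Qed.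

Lemma Tfrac_cvg a b H :
    (forall k, H k = (1 - fpsC (b k) * fpsX) * H k.+1
                     - fpsC (a k.+1) * fpsX * H k.+2) ->
    coefs (H 0) 0 = 1 ->
  fps_cvg (Tfrac a b) (H 1 / H 0).
Proof.
move=> recH /fps_unit_coefs0 uH k; exists k => n le_kn.
have [h Eh] := Tfrac_remainder n recH.
have -> : Tfrac a b n = H 1 / H 0 + fpsX ^+ n.+1 * (h / H 0).
  by rewrite mulrA -Eh mulrBl mulrK // addrC subrK.
by rewrite coefsD coefsXnM ?addr0 // ltnS.
Qed.

Lemma Sfrac_cvg l H :
    (forall k, H k = H k.+1 - fpsC (l k.+1) * fpsX * H k.+2) ->
    coefs (H 0) 0 = 1 ->
  fps_cvg (Sfrac l) (H 1 / H 0).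
Proof.
move=> recH H0 k.
have [j | N HN] := @Tfrac_cvg l (fun=> 0) H _ H0 k.
  by rewrite fpsC0 mul0r subr0 mul1r; apply: recH.
by exists N => n le_Nn; rewrite Sfrac_Tfrac HN.
Qed.

End Recurrences.

(** * A basic hypergeometric series and its contiguous relations *)

Section Qhyp.
Variables (K : fieldType) (c q : K).
Hypothesis q_nz : forall n, 1 - q ^+ n.+1 != 0.
Hypothesis cq_nz : forall n, 1 - c * q ^+ n != 0.

Definition qpoch (x : K) n := \prod_(i < n) (1 - x * q ^+ i).

Lemma qpochSr x n : qpoch x n.+1 = qpoch x n * (1 - x * q ^+ n).
Proof. by rewrite /qpoch big_ord_recr. Qed.

Lemma qpochSl x n : qpoch x n.+1 = (1 - x) * qpoch (x * q) n.
Proof.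
rewrite /qpoch big_ord_recl expr0 mulr1; congr (_ * _).
by apply: eq_bigr => i _; rewrite -mulrA -exprS.
Qed.

Lemma qpoch_q_nz n : qpoch q n != 0.
Proof. by apply/prodf_neq0 => i _; rewrite -exprS. Qed.

Lemma qpoch_cq_nz k n : qpoch (c * q ^+ k) n != 0.
Proof. by apply/prodf_neq0 => i _; rewrite -mulrA -exprD. Qed.

Definition qhyp m k : fps K :=
  Fps (fun n => (-1) ^+ n * q ^+ ('C(n, 2) + m * n)
                / (qpoch q n * qpoch (c * q ^+ k) n)).

Lemma coefs0_qhyp m k : coefs (qhyp m k) 0 = 1.
Proof. by rewrite /= muln0 /qpoch !big_ord0 !mulr1 divr1. Qed.

(** The series is hypergeometric: moving [m], [k] or the index by one multiplies
a coefficient by a rational function of [q ^+ m], [q ^+ k] and [q ^+ n]. The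
next three lemmas thus reduce each contiguous relation to an identity between
rational functions. *)
Lemma coefs_qhyp_Sm m k n :
  coefs (qhyp m.+1 k) n = q ^+ n * coefs (qhyp m k) n.
Proof. by rewrite /= mulSn addnCA exprD; ring. Qed.

Lemma coefs_qhyp_Sk m k n :
  coefs (qhyp m k.+1) n
    = (1 - c * q ^+ k) / (1 - c * q ^+ k * q ^+ n) * coefs (qhyp m k) n.
Proof.
have E : (1 - c * q ^+ k) * qpoch (c * q ^+ k.+1) n
         = qpoch (c * q ^+ k) n * (1 - c * q ^+ k * q ^+ n).
  by rewrite exprSr mulrA -qpochSl qpochSr.
have := cq_nz k; have := cq_nz (k + n); rewrite /= exprD mulrA => nz1 nz2.
have := qpoch_cq_nz k n; have := qpoch_cq_nz k.+1 n; have := qpoch_q_nz n.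
move: E; set P := qpoch q n.
set Q := qpoch (c * q ^+ k) n; set Q' := qpoch (c * q ^+ k.+1) n.
move=> E nzP nzQ' nzQ.
have -> : Q' = Q * (1 - c * q ^+ k * q ^+ n) / (1 - c * q ^+ k).
  by rewrite -E mulrAC mulfV // mul1r.
by field; rewrite nzP nzQ nz1 nz2.
Qed.

Lemma coefs_qhyp_Sn m k n :
  coefs (qhyp m k) n.+1
    = - (q ^+ m * q ^+ n
         / ((1 - q ^+ n.+1) * (1 - c * q ^+ k * q ^+ n)))
      * coefs (qhyp m k) n.
Proof.
rewrite /= !qpochSr binS bin1 mulnS -exprS.
have := cq_nz (k + n); rewrite exprD mulrA => nz.
have := qpoch_cq_nz k n; have := qpoch_q_nz n; have := q_nz n.
have -> : ('C(n, 2) + n + (m + m * n) = m + n + ('C(n, 2) + m * n))%N by ring.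
rewrite [(-1) ^+ n.+1]exprS !exprD => nz1 nz2 nz3.
by field; rewrite nz nz1 nz2 nz3.
Qed.

(** Over a common denominator the [n]-th coefficients of [qhyp m.+1 k.+1] and
[qhyp m k] differ by the factor
[q ^+ n * (1 - c * q ^+ k) - (1 - c * q ^+ (k + n)) = - (1 - q ^+ n)].
It cancels the last factor of [qpoch q n], which shifts the index by one. *)
Lemma qhyp_shift_both m k :
  qhyp m k = qhyp m.+1 k.+1
    - fpsC (q ^+ m / ((1 - c * q ^+ k) * (1 - c * q ^+ k.+1))) * fpsX
      * qhyp m.+1 k.+2.
Proof.
apply: fpsP => -[|n]; rewrite coefsD coefsN -mulrA coefsCM.
  by rewrite coefs0XM mulr0 subr0 !coefs0_qhyp.
rewrite coefsXM 2!coefs_qhyp_Sm 3!coefs_qhyp_Sk coefs_qhyp_Sn.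
have := cq_nz k; have := cq_nz k.+1; have := q_nz n.
have := cq_nz (k + n); have := cq_nz (k + n).+1; rewrite !exprS exprD.
move=> nz1 nz2 nz3 nz4 nz5; field.
by rewrite -!mulrA nz1 nz2 nz3 nz4 nz5.
Qed.

(** The same cancellation, now from
[(1 - c * q ^+ k) - (1 - c * q ^+ (k + n)) = - c * q ^+ k * (1 - q ^+ n)]. *)
Lemma qhyp_shift_lower m k :
  qhyp m k = qhyp m k.+1
    - fpsC (c * q ^+ (m + k) / ((1 - c * q ^+ k) * (1 - c * q ^+ k.+1))) * fpsX
      * qhyp m.+1 k.+2.
Proof.
apply: fpsP => -[|n]; rewrite coefsD coefsN -mulrA coefsCM.
  by rewrite coefs0XM mulr0 subr0 !coefs0_qhyp.
rewrite coefsXM coefs_qhyp_Sm 3!coefs_qhyp_Sk coefs_qhyp_Sn.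
have := cq_nz k; have := cq_nz k.+1; have := q_nz n.
have := cq_nz (k + n); have := cq_nz (k + n).+1; rewrite !exprS !exprD.
move=> nz1 nz2 nz3 nz4 nz5; field.
by rewrite -!mulrA nz1 nz2 nz3 nz4 nz5.
Qed.

(** Here the coefficients combine through
[1 = (1 - c * q ^+ (k + n)) + c * q ^+ k * q ^+ n], and no factor of
[qpoch q n] cancels, so the index stays in place. *)
Lemma qhyp_shift_split m k :
  fpsC (1 - c * q ^+ k)^-1 * qhyp m k.+1
    = qhyp m k + fpsC (c * q ^+ k / (1 - c * q ^+ k)) * qhyp m.+1 k.+1.
Proof.
apply: fpsP => n; rewrite coefsD !coefsCM.
rewrite coefs_qhyp_Sm coefs_qhyp_Sk.
have := cq_nz k; have := cq_nz (k + n); rewrite exprD mulrA => nz1 nz2.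
by field; rewrite nz1 nz2.
Qed.

(** [qhyp_shift_both] leaves the diagonal, at [qhyp k.+1 k.+2]; splitting this
series brings it back. The first summand contributes the [b_k] term, the second
the [a_(k+1)] term. *)
Lemma qhyp_diagonal_rec k :
  qhyp k k = (1 - fpsC (q ^+ k / (1 - c * q ^+ k)) * fpsX) * qhyp k.+1 k.+1
    - fpsC (c * q ^+ (k + k.+1) / ((1 - c * q ^+ k) * (1 - c * q ^+ k.+1)))
      * fpsX * qhyp k.+2 k.+2.
Proof.
rewrite [LHS]qhyp_shift_both.
set B := q ^+ k / (1 - c * q ^+ k).
have -> : q ^+ k / ((1 - c * q ^+ k) * (1 - c * q ^+ k.+1))
          = B * (1 - c * q ^+ k.+1)^-1 by rewrite invfM mulrA.
have -> : c * q ^+ (k + k.+1) / ((1 - c * q ^+ k) * (1 - c * q ^+ k.+1))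
          = B * (c * q ^+ k.+1 / (1 - c * q ^+ k.+1)).
  by rewrite /B invfM exprD; ring.
have E := qhyp_shift_split k.+1 k.+1.
rewrite (fpsCM B (1 - _)^-1) (fpsCM B (_ / _)).
rewrite -!mulrA [fpsC _^-1 * _]mulrCA E [c * (_ / _)]mulrA; ring.
Qed.

(** The path (0, 0), (1, 1), (1, 2), (2, 3), (2, 4), ... of parameters is the
one on which [qhyp_shift_both] and [qhyp_shift_lower] can be applied in turn. *)
Definition qhyp_stair k := qhyp (uphalf k) k.

Lemma qhyp_stair_rec_even m :
  qhyp_stair (m.*2)
    = qhyp_stair m.*2.+1
      - fpsC (q ^+ m / ((1 - c * q ^+ m.*2) * (1 - c * q ^+ m.*2.+1))) * fpsX
        * qhyp_stair m.*2.+2.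
Proof.
by rewrite /qhyp_stair /= uphalf_double doubleK [LHS]qhyp_shift_both.
Qed.

Lemma qhyp_stair_rec_odd m :
  qhyp_stair m.*2.+1
    = qhyp_stair m.*2.+2
      - fpsC (c * q ^+ (m.+1 + m.*2.+1)
              / ((1 - c * q ^+ m.*2.+1) * (1 - c * q ^+ m.*2.+2))) * fpsX
        * qhyp_stair m.*2.+3.
Proof.
by rewrite /qhyp_stair /= uphalf_double doubleK [LHS]qhyp_shift_lower.
Qed.

End Qhyp.

(** * The indeterminates are generic *)

Lemma tofrac_neq0_at0 (p : {mpoly rat[2]}) :
  p.@[fun=> 0] != 0 -> tofrac p != 0.
Proof. by rewrite tofrac_eq0; apply: contra_neq => ->; rewrite meval0. Qed.

Lemma q_generic n : 1 - Defs.q ^+ n.+1 != 0.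
Proof.
rewrite /Defs.q -tofracXn -tofrac1 -tofracB tofrac_neq0_at0 //.
by rewrite mevalB meval1 rmorphXn /= mevalXU expr0n subr0 oner_neq0.
Qed.

Lemma cq_generic n : 1 - Defs.c * Defs.q ^+ n != 0.
Proof.
rewrite /Defs.c /Defs.q -tofracXn -tofracM -tofrac1 -tofracB tofrac_neq0_at0 //.
by rewrite mevalB meval1 mevalM mevalXU mul0r subr0 oner_neq0.
Qed.

Theorem corollary5p6 :
  exists F : fps Qcq, fps_cvg (Tfrac a_ b_) F /\ fps_cvg (Sfrac lambda_) F.
Proof.
pose phi := qhyp Defs.c Defs.q; exists (phi 1 1 / phi 0 0); split.
  apply: (@Tfrac_cvg _ a_ b_ (fun k => phi k k)) => [k|]; last first.
    exact: coefs0_qhyp.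
  rewrite {1}/phi (qhyp_diagonal_rec q_generic cq_generic) /a_ /b_ subSS subn0.
  by rewrite (_ : 2 * k.+1 - 1 = k + k.+1)%N //; lia.
apply: (@Sfrac_cvg _ _ (qhyp_stair Defs.c Defs.q)) => [k|]; last first.
  exact: coefs0_qhyp.
rewrite -(odd_double_half k); case: (odd k); move: k./2 => m {k}.
  rewrite add1n (qhyp_stair_rec_odd q_generic cq_generic).
  rewrite /lambda_ /= !odd_double doubleK.
  by rewrite (_ : 3 * m.+1 - 1 = m.+1 + m.*2.+1)%N; last lia;
     rewrite (_ : 2 * m.+1 - 1 = m.*2.+1)%N; last lia;
     rewrite (_ : 2 * m.+1 = m.*2.+2)%N; last lia.
rewrite add0n (qhyp_stair_rec_even q_generic cq_generic).
by rewrite /lambda_ /= !odd_double /= uphalf_double mul2n addn1.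
Qed.
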